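(* Let $n\ge 2$, let $H\le\mathbb{Z}_n$ be a subgroup of size $t\ge 3$, and let $A\subseteq\mathbb{Z}_n$. Choose a coset $C=a+H$ of $H$ maximizing $x:=|A\cap C|$, and set $r:=r_H(A)-1$. Define $$\alpha^\star:=\max\{0,\ \min\{p(t),\ 2x-3\}\}.$$ Then $$|A\widehat{+}A|\ \ge\ \alpha^\star+rx.$$
   Context: $\mathbb{Z}_n$ denotes the additive cyclic group of integers modulo $n$. For $A\subseteq\mathbb{Z}_n$ the restricted self-sumset is $A\widehat{+}A=\{a+a' : a,a'\in A,\ a\ne a'\}\subseteq\mathbb{Z}_n$ (so it is empty, of size $0$, when $|A|\le 1$). For a subgroup $H\le\mathbb{Z}_n$, $r_H(A)$ denotes the number of $H$-cosets that meet $A$, i.e. the size of the image of $A$ in $\mathbb{Z}_n/H$; thus $r=r_H(A)-1$ (an integer) is, for nonempty $A$, the number of $H$-cosets other than $C$ that meet $A$. For an integer $t\ge 2$, $p(t)$ is the least prime divisor of $t$. *)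

(* Defs.v *)
From HB Require Import structures.
From mathcomp Require Import all_boot all_order all_algebra all_fingroup.

Set Implicit Arguments.
Unset Strict Implicit.
Unset Printing Implicit Defensive.

Import Order.TTheory GRing.Theory Num.Theory.
Local Open Scope ring_scope.

Definition restricted_sumset (G : finZmodType) (A : {set G}) : {set G} :=
  [set a + a' | a in A, a' in A & a != a'].

(* The group law of the finGroupType 'Z_n is addition modulo n, so the
   multiplicatively written coset (a *: H)%g is a + H. *)
Definition cosets (n : nat) (H : {group 'Z_n}) : {set {set 'Z_n}} :=
  lcosets H [set: 'Z_n].

Definition num_cosets_meeting (n : nat) (H : {group 'Z_n}) (A : {set 'Z_n}) :
    nat :=
  #|[set C in cosets H | A :&: C != set0]|.

(* Integer valued, since 2x - 3 is negative for x = 0, 1; pdiv t is the least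
   prime divisor of t > 1. *)
Definition alpha_star (t x : nat) : int :=
  Num.max 0 (Num.min (pdiv t)%:Z (2 * x%:Z - 3)).

(* Main.v *)
(* A is spread over the cosets of H. For each coset D <> C meeting A, adding one
   point of A in D to all of A :&: C gives x sums in the coset C + D, so it
   remains to find min(p(t), 2x - 3) sums in C + C: the Erdos-Heilbronn problem
   in H (Karolyi's theorem). In prime order this is the polynomial method of
   Alon, Nathanson and Ruzsa, with the Combinatorial Nullstellensatz replaced
   by weights w on A that annihilate the monomials of degree < |A| - 1.
   Otherwise take a proper nontrivial subgroup K of H. If A meets every K-coset
   at most once, use H / K. If not, let k >= 2 be the size of the largest
   intersections, c1 a coset attaining k, U the set of cosets attaining k and M
   the set of all cosets that meet A. The sums lying in c1 + M are counted in K,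
   by Cauchy-Davenport and the induction hypothesis; the loss, |U| - 1, is made
   up by the at least |U| - 1 elements of (U + M) \ (c1 + M), given by
   Cauchy-Davenport in H / K, each of which contains a sum because k >= 2. *)

Require Import Defs.
From HB Require Import structures.
From mathcomp Require Import all_boot all_order all_algebra all_fingroup.
From mathcomp Require Import cyclic pgroup zify ring.

Set Implicit Arguments.
Unset Strict Implicit.
Unset Printing Implicit Defensive.

Import Order.TTheory GRing.Theory Num.Theory.
Local Open Scope ring_scope.

(** * The polynomial method over a field *)

(* These are the divided difference weights w x = \prod_(y != x) (x - y)^-1. *)
Lemma moment_weights (F : fieldType) (A : seq F) : uniq A ->
  exists w : F -> F, forall i, (i < size A)%N ->
    \sum_(x <- A) w x * x ^+ i = (i.+1 == size A)%:R.
Proof.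
elim: A => [|x0 A IHA] /=; first by move=> _; exists (fun=> 0).
case/andP=> x0A /IHA[w' w'P]; case: A => [|x1 A] in IHA x0A w'P *.
  by exists (fun=> 1) => -[|//] _; rewrite big_seq1 mulr1.
set B := x1 :: A in x0A w'P *.
pose w x := if x == x0 then - \sum_(y <- B) w' y / (y - x0)
            else w' x / (x - x0).
have wB x : x \in B -> w x = w' x / (x - x0).
  by rewrite /w; case: eqP => // ->; rewrite (negPf x0A).
pose W i := \sum_(x <- x0 :: B) w x * x ^+ i.
have W0 : W 0 = 0.
  rewrite /W big_cons {1}/w eqxx expr0 mulr1 big_seq.
  rewrite [X in _ + X](eq_big_seq (fun y => w' y / (y - x0))).
    by rewrite -big_seq addNr.
  by move=> y yB; rewrite mulr1 wB.
(* Writing x as x0 + (x - x0), the second term cancels the denominators of [w]; the weight at [x0]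
   was chosen only to make [W 0] vanish. *)
have WS i : W i.+1 = x0 * W i + \sum_(x <- B) w' x * x ^+ i.
  apply/eqP; rewrite addrC -subr_eq /W mulr_sumr -sumrB big_cons.
  rewrite exprS mulrCA subrr add0r; apply/eqP/eq_big_seq => x xB.
  have xx0 : x - x0 != 0 by rewrite subr_eq0; apply: contraNneq x0A => <-.
  by rewrite wB // exprS; field.
exists w; elim=> [|i IHi] lt_i; first exact: W0.
rewrite -/(W _) WS {1}/W IHi 1?ltnW // w'P // /= eqSS.
by move: lt_i; rewrite ltnS => lt_i; rewrite (ltn_eqF lt_i) mulr0 add0r.
Qed.

(* The witness is f(x, y) = (x - y) P(x + y), which vanishes on A x A' (A' is A
   minus a point) although its coefficient at x^(m+1) y^m, for |A| = m + 2, is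
   the Catalan number 'C(2m, m) - 'C(2m, m+1), a divisor of (2m)!. *)
Lemma erdos_heilbronn_field (F : fieldType) (A C : seq F) :
    uniq A -> {in A &, forall x y, x != y -> x + y \in C} ->
    ((2 * size A - 4)`!)%:R != 0 :> F ->
  (2 * size A <= size C + 3)%N.
Proof.
move=> uA AC fact_neq0; rewrite leqNgt; apply/negP => ltC.
have [m [x0 [A' [eA sA']]]] : exists m x0 A', A = x0 :: A' /\ size A' = m.+1.
  by case: (A) ltC => [|a [|b s]] /= ?; [lia|lia|exists (size s), a, (b :: s)].
have sA : size A = m.+2 by rewrite eA /= sA'.
have uA' : uniq A' by move: uA; rewrite eA => /andP[].
rewrite sA (_ : 2 * m.+2 - 4 = 2 * m)%N in fact_neq0; last by lia.
rewrite sA in ltC.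
have {}ltC : (size C <= 2 * m)%N by lia.
have [w wP] := moment_weights uA; have [v vP] := moment_weights uA'.
rewrite sA in wP; rewrite sA' in vP.
pose W i := \sum_(x <- A) w x * x ^+ i; pose V i := \sum_(x <- A') v x * x ^+ i.
pose L k := \sum_(x <- A) \sum_(y <- A') w x * v y * ((x - y) * (x + y) ^+ k).
have LE k : L k = \sum_(i < k.+1)
    (W i.+1 * V (k - i)%N - W i * V (k - i).+1) *+ 'C(k, i).
  transitivity (\sum_(x <- A) \sum_(y <- A') \sum_(i < k.+1)
      (w x * v y * ((x - y) * (x ^+ i * y ^+ (k - i)))) *+ 'C(k, i)).
    apply: eq_bigr => x _; apply: eq_bigr => y _.
    rewrite [x + y]addrC exprDn !mulr_sumr; apply: eq_bigr => i _.
    by rewrite !mulrnAr; congr (_ *+ _); ring.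
  under eq_bigr do rewrite exchange_big.
  rewrite exchange_big; apply: eq_bigr => i _ /=.
  rewrite !big_distrlr /= -sumrB -sumrMnl; apply: eq_bigr => x _.
  rewrite -sumrB -sumrMnl; apply: eq_bigr => y _.
  by rewrite !exprS; congr (_ *+ _); ring.
(* In total degree at most 2m + 1, the only monomial not annihilated by the product weights is
   x^(m+1) y^m: either i <= m, or j <= m with equality only for i = m + 1. *)
have WV i j : (i + j <= 2 * m + 1)%N ->
    W i * V j = ((i == m.+1) && (j == m))%N%:R.
  move=> ijm; have [im | mi] := ltnP i m.+1.
    by rewrite [W i]wP ?[i.+1 == _]ltn_eqF ?mul0r ?[i == _]ltn_eqF //; lia.
  rewrite [V j]vP ?eqSS; last by lia.
  have [jm|_] := eqVneq j m; last by rewrite mulr0 andbF.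
  by rewrite mulr1 andbT [W i]wP ?eqSS //; lia.
have L0 k : (k < 2 * m)%N -> L k = 0.
  move=> km; rewrite LE big1 // => i _; have := ltn_ord i => ik.
  rewrite !WV; try lia.
  have -> : (i.+1 == m.+1) && ((k - i)%N == m) = false by lia.
  have -> : (i == m.+1 :> nat) && ((k - i).+1 == m) = false by lia.
  by rewrite subrr mul0rn.
have Lm : L (2 * m)%N = ('C(2 * m, m))%:R - ('C(2 * m, m.+1))%:R.
  rewrite LE; under eq_bigr do rewrite mulrnBl.
  rewrite sumrB; congr (_ - _).
    have lem : (m < (2 * m).+1)%N by lia.
    rewrite (bigD1 (Ordinal lem)) //= WV; last by lia.
    rewrite [_ && _](_ : _ = true) ?big1 ?addr0 //; last by lia.
    move=> i /negP/negP im; have := ltn_ord i => ik; rewrite WV; last by lia.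
    have : (i != m :> nat) by [].
    by move=> ?; rewrite [_ && _](_ : _ = false) ?mul0rn //; lia.
  have [m0 | m_gt0] := posnP m.
    rewrite bin_small; last by lia.
    rewrite big1 // => i _; have := ltn_ord i => ik.
    rewrite WV; last by lia.
    have -> : (i == m.+1 :> nat) && ((2 * m - i).+1 == m) = false by lia.
    by rewrite mul0rn.
  have lem : (m.+1 < (2 * m).+1)%N by lia.
  rewrite (bigD1 (Ordinal lem)) //= WV; last by lia.
  rewrite [_ && _](_ : _ = true) ?big1 ?addr0 //; last by lia.
  move=> i /negP/negP im; have := ltn_ord i => ik; rewrite WV; last by lia.
  have : (i != m.+1 :> nat) by [].
  by move=> ?; rewrite [_ && _](_ : _ = false) ?mul0rn //; lia.
(* If the two binomials agree in [F], then (m+1) 'C(2m, m+1) = m 'C(2m, m) forces 'C(2m, m) = 0,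
   hence (2m)! = 0. *)
have Lm_neq0 : L (2 * m)%N != 0.
  apply: contra fact_neq0; rewrite Lm subr_eq0 => /eqP eC.
  have := mul_bin_left (2 * m) m; rewrite (_ : 2 * m - m = m)%N; last by lia.
  move/(congr1 (fun k => k%:R : F)); rewrite !natrM -eC -natr1 mulrDl mul1r.
  move/eqP; rewrite -subr_eq0 addrAC subrr add0r => /eqP C0.
  have /(congr1 (fun k => k%:R : F)) := @bin_fact (2 * m) m ltac:(lia).
  by rewrite natrM C0 mul0r => <-.
(* The power of ['X] pads the degree to exactly 2m, so that pairing with [L] leaves the leading
   coefficient times [L (2 * m)]. *)
pose P := 'X^(2 * m - size C) * \prod_(c <- C) ('X - c%:P).
have monP : P \is monic by rewrite rpredM ?monicXn ?monic_prod_XsubC.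
have sP : size P = (2 * m).+1.
  rewrite /P size_monicM ?monicXn ?monic_neq0 ?monic_prod_XsubC //.
  by rewrite size_polyXn size_prod_XsubC; lia.
have PC c : c \in C -> P.[c] = 0.
  move=> cC; rewrite /P hornerM [X in _ * X](_ : _ = 0) ?mulr0 //.
  by apply/rootP; rewrite root_prod_XsubC.
have : \sum_(k < size P) P`_k * L k = 0.
  transitivity (\sum_(x <- A) \sum_(y <- A') w x * v y * ((x - y) * P.[x + y])).
    under eq_bigr do rewrite mulr_sumr.
    rewrite exchange_big; apply: eq_bigr => x _.
    under eq_bigr do rewrite mulr_sumr.
    rewrite exchange_big; apply: eq_bigr => y _.
    by rewrite horner_coef !mulr_sumr; apply: eq_bigr => k _; ring.
  rewrite big_seq big1 // => x xA; rewrite big_seq big1 // => y yA'.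
  have [->|xy] := eqVneq x y; first by rewrite subrr mul0r mulr0.
  by rewrite PC ?mulr0 // AC // eA inE yA' orbT.
rewrite sP big_ord_recr /= big1 => [|k _]; last by rewrite L0 ?mulr0.
have -> : P`_(2 * m) = 1 by move/monicP: monP; rewrite /lead_coef sP.
by rewrite add0r mul1r; apply/eqP.
Qed.

(** * Cauchy-Davenport in commutative groups *)

Section GroupSumsets.

Local Open Scope group_scope.

(** A lower bound instead of [pdiv m], so that one fixed [p] serves for all subgroups and quotients,
    the trivial ones included. *)
Definition prime_divisors_ge (p m : nat) :=
  forall q, prime q -> (q %| m)%N -> (p <= q)%N.

Lemma prime_divisors_ge_dvdn p m d :
  (d %| m)%N -> prime_divisors_ge p m -> prime_divisors_ge p d.
Proof. by move=> dm pm q q_pr qd; apply: pm => //; apply: dvdn_trans dm. Qed.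

Lemma leq_prime_divisors_ge p m :
  (1 < m)%N -> prime_divisors_ge p m -> (p <= m)%N.
Proof.
move=> m1 pm; apply: leq_trans (pdiv_leq (ltnW m1)).
by apply: pm; [apply: pdiv_prime | apply: pdiv_dvd].
Qed.

(* Only B has to lie in a coset of K: the transform below shrinks B, and stops
   when A contains a translate of the group generated by B / b, of order >= p. *)
Lemma cauchy_davenport (gT : finGroupType) (p : nat) (K : {group gT})
    (A B : {set gT}) :
    commutative (@mulg gT) -> prime_divisors_ge p #|K| ->
    A != set0 -> B != set0 -> {in B &, forall b c, b^-1 * c \in K} ->
    (#|A| + #|B| <= p.+1)%N ->
  (#|A| + #|B| <= #|(A * B)%g| + 1)%N.
Proof.
move=> mulC Kp; have [m] := ubnP #|B|; elim: m A B => // m IHm A B ltBm.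
move=> A0 B0 BK ABp.
have [/exists_inP[a aA /exists_inP[b bB nsub]]|] :=
    boolP [exists a in A, exists b in B, ~~ ((a * b^-1) *: B \subset A)].
  (* Dyson's e-transform: it preserves the sum of the sizes, does not enlarge the product set, and
     shrinks [B] strictly because e B is not inside A. *)
  set e := a * b^-1 in nsub; pose eB := e *: B.
  pose A1 := A :|: eB; pose B1 := B :&: (e^-1 *: A).
  have eB1 : e *: B1 = A :&: eB.
    rewrite /B1 -!lcosetE; apply/setP=> y.
    by rewrite !lcosetE !(inE, mem_lcoset) invgK mulKVg andbC.
  have cAB : (#|A1| + #|B1| = #|A| + #|B|)%N.
    by rewrite -(card_lcoset B1 e) eB1 cardsUI card_lcoset.
  have bB1 : b \in B1 by rewrite inE bB mem_lcoset invgK mulgKV.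
  have sB1B : B1 \subset B by apply: subsetIl.
  have ltB1 : (#|B1| < #|B|)%N.
    apply: proper_card; rewrite properEneq sB1B andbT.
    apply: contra nsub => /eqP eB1B.
    by rewrite -{1}eB1B eB1 subsetIl.
  have sAB : A1 * B1 \subset A * B.
    apply/subsetP=> _ /mulsgP[u v uA1 vB1 ->].
    have vB := subsetP sB1B v vB1; move: uA1; rewrite inE => /orP[uA|].
      exact: mem_mulg.
    rewrite mem_lcoset => uB; rewrite -[u](mulKVg e) mulC mulgA.
    rewrite [v * e]mulC; apply: mem_mulg => //.
    by move: vB1; rewrite inE mem_lcoset invgK => /andP[].
  rewrite -cAB; apply: (leq_trans (IHm A1 B1 _ _ _ _ _)).
  - by lia.
  - by apply: contraNneq A0 => A10; rewrite -subset0 -A10 subsetUl.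
  - by apply/set0Pn; exists b.
  - by apply: sub_in2 BK => y; apply: (subsetP sB1B).
  - by rewrite cAB.
  by rewrite leq_add2r subset_leq_card.
(* No transform shrinks [B] any more, so [A] is stable under multiplication by b^-1 B. *)
move/exists_inPn=> ABA.
have [/set0Pn[a aA] /set0Pn[b bB]] := (A0, B0).
have [B1 | ltB1] := leqP #|B| 1.
  have : (#|A| <= #|(A * B)%g|)%N.
    rewrite -(card_rcoset A b) subset_leq_card //.
    by rewrite mulgS // sub1set.
  lia.
pose D := b^-1 *: B.
have AD : A * D \subset A.
  apply/subsetP=> _ /mulsgP[u _ uA /lcosetP[v vB ->] ->].
  have /exists_inPn/(_ b bB) := ABA u uA; rewrite negbK => /subsetP; apply.
  by rewrite mulgA mem_lcoset mulKg.
have sDA : a *: <<D>> \subset A.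
  apply/subsetP=> _ /lcosetP[d /gen_prodgP[k [f fD ->]] ->].
  elim: k f fD => [|k IHk] f fD; first by rewrite big_ord0 mulg1.
  rewrite big_ord_recr /= mulgA; apply: (subsetP AD); apply: mem_mulg => //.
  by apply: IHk.
have sDK : <<D>> \subset K.
  by rewrite gen_subG; apply/subsetP=> _ /lcosetP[v vB ->]; apply: BK.
have leD : (#|B| <= #|<<D>>|)%N.
  by rewrite -(card_lcoset B b^-1) subset_leq_card // subset_gen.
have leDA : (#|<<D>>| <= #|A|)%N.
  by rewrite -(card_lcoset <<D>> a) subset_leq_card.
have lepD : (p <= #|<<D>>|)%N.
  apply: leq_prime_divisors_ge (leq_trans ltB1 leD) _.
  exact: prime_divisors_ge_dvdn (cardSg sDK) Kp.
(* Now |A| >= p and |B| >= 2, against |A| + |B| <= p + 1. *)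
have := leq_trans lepD leDA; lia.
Qed.

(** * Restricted product sets and groups of prime order *)

(** Multiplicative, since the induction passes through quotient groups; on ['Z_n] it is convertible
    to [restricted_sumset]. *)
Definition restricted_prodset (gT : finGroupType) (A : {set gT}) : {set gT} :=
  [set x * y | x in A, y in A & x != y].

Lemma mem_restricted_prodset (gT : finGroupType) (A : {set gT}) x y :
  x \in A -> y \in A -> x != y -> x * y \in restricted_prodset A.
Proof. by move=> xA yA xy; apply/imset2P; exists x y; rewrite ?inE ?yA. Qed.

Lemma restricted_prodsetS (gT : finGroupType) (A B : {set gT}) :
  A \subset B -> restricted_prodset A \subset restricted_prodset B.
Proof.
move=> /subsetP sAB; apply/subsetP=> z /imset2P[x y xA].
rewrite inE => /andP[yA xy] ->; apply: mem_restricted_prodset => //; exact: sAB.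
Qed.

Lemma card_restricted_prodset_lcoset (gT : finGroupType) (A : {set gT}) a :
  commutative (@mulg gT) ->
  #|restricted_prodset (a *: A)| = #|restricted_prodset A|.
Proof.
move=> mulC; rewrite -(card_lcoset (restricted_prodset A) (a * a)).
have aM x y : a * x * (a * y) = a * a * (x * y).
  by rewrite -!mulgA (mulgA x) (mulC x) -!mulgA.
apply: eq_card => z; apply/imset2P/lcosetP.
  case=> u v /lcosetP[x xA ->]; rewrite inE => /andP[/lcosetP[y yA ->]].
  rewrite (inj_eq (mulgI a)) => xy ->; exists (x * y) => //.
  exact: mem_restricted_prodset.
case=> w /imset2P[x y xA]; rewrite inE => /andP[yA xy] -> ->.
exists (a * x) (a * y) => //; rewrite ?inE ?mem_lcoset ?mulKg //.
by rewrite (inj_eq (mulgI a)) yA.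
Qed.

(** Powers of a generator identify [H] with the additive group of ['F_q]. The size bound gives 2|A|
    - 4 < q, so the factorial required over the field is nonzero. *)
Lemma erdos_heilbronn_prime_order (gT : finGroupType) (H : {group gT})
    (A : {set gT}) :
    prime #|H| -> A \subset H -> (2 * #|A| <= #|H| + 3)%N ->
  (2 * #|A| <= #|restricted_prodset A| + 3)%N.
Proof.
move=> H_pr sAH leA; have /cyclicP[h defH] := prime_cyclic H_pr.
have oh : #[h] = #|H| by rewrite defH.
set q := #|H| in H_pr leA oh.
pose f (i : 'F_q) := h ^+ i.
have fD i j : f (i + j)%R = f i * f j.
  rewrite /f -expgD -[RHS]expg_mod_order oh; congr (h ^+ _).
  by rewrite -[X in (_ %% X)%N](Fp_cast H_pr).
have ltq (i : 'F_q) : (i < q)%N.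
  by rewrite -[X in (_ < X)%N](Fp_cast H_pr) ltn_ord.
have f_inj : injective f.
  move=> i j /eqP; rewrite eq_expg_mod_order oh !modn_small ?ltq //.
  by move/eqP/val_inj.
have fH x : x \in H -> exists i, x = f i.
  rewrite defH => /cyclePmin[i]; rewrite oh => iq ->; exists (inord i).
  by rewrite /f /= insubdK // unfold_in /= -/(pdiv q) Fp_cast.
have card_pre (X : {set gT}) : X \subset H -> #|f @^-1: X| = #|X|.
  move=> sXH; rewrite -(card_imset _ f_inj); apply: eq_card => x.
  apply/imsetP/idP => [[i]|xX]; first by rewrite inE => ? ->.
  by have [i xi] := fH x (subsetP sXH x xX); exists i; rewrite // inE -xi.
have sRH : restricted_prodset A \subset H.
  apply/subsetP=> z /imset2P[x y xA]; rewrite inE => /andP[yA _] ->.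
  by rewrite groupM ?(subsetP sAH).
rewrite -(card_pre _ sAH) -(card_pre _ sRH) cardE [X in (_ <= X + _)%N]cardE.
apply: erdos_heilbronn_field; rewrite ?enum_uniq //.
  move=> i j; rewrite !mem_enum !inE => iA jA ij; rewrite fD.
  by apply: mem_restricted_prodset; rewrite ?(inj_eq f_inj).
rewrite -cardE (card_pre _ sAH) -(dvdn_pcharf (pchar_Fp H_pr)).
have : (2 * #|A| - 4 < q)%N by have := prime_gt1 H_pr; lia.
elim: (_ - 4)%N => [|k IHk] kq; first by rewrite fact0 gtnNdvd ?prime_gt1.
by rewrite factS Euclid_dvdM // negb_or IHk ?gtnNdvd //; lia.
Qed.

(** * Erdos-Heilbronn for an extension of [H / K] by [K] *)

Lemma sum_card_preim1 (T I : finType) (f : T -> I) (S : {set T}) (P : {set I}) :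
  (\sum_(c in P) #|S :&: f @^-1: [set c]| = #|S :&: f @^-1: P|)%N.
Proof.
rewrite -sum1_card (partition_big f (mem P)) /= => [|x]; last first.
  by rewrite !inE => /andP[].
apply: eq_bigr => c cP; rewrite -sum1_card; apply: eq_bigl => x; rewrite !inE.
by have [->|] := eqVneq (f x) c; rewrite ?andbF ?andbT // cP andbT.
Qed.

Lemma coset_of_mulC (gT : finGroupType) (K : {group gT}) :
  commutative (@mulg gT) -> commutative (@mulg (coset_of K)).
Proof.
move=> mulC u v; have [x nKx ->] := cosetP u; have [y nKy ->] := cosetP v.
by rewrite -!morphM // mulC.
Qed.

Lemma erdos_heilbronn_extension (gT : finGroupType) (p : nat)
    (H K : {group gT}) (A : {set gT}) :
    commutative (@mulg gT) -> K \subset H -> prime_divisors_ge p #|H| ->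
    (forall B : {set gT}, B \subset K -> (2 * #|B| <= p + 3)%N ->
       (2 * #|B| <= #|restricted_prodset B| + 3)%N) ->
    (forall B : {set coset_of K}, B \subset H / K -> (2 * #|B| <= p + 3)%N ->
       (2 * #|B| <= #|restricted_prodset B| + 3)%N) ->
    A \subset H -> (2 * #|A| <= p + 3)%N ->
  (2 * #|A| <= #|restricted_prodset A| + 3)%N.
Proof.
move=> mulC sKH Hp EH_K EH_HK sAH leA.
have nK x : x \in 'N(K).
  by rewrite inE; apply/subsetP=> _ /imsetP[y yK ->]; rewrite conjgE mulC mulgK.
pose f := coset K.
have fM x y : f (x * y) = f x * f y by apply: morphM.
have mulCq := @coset_of_mulC gT K mulC.
have fK x y : f x = f y -> x^-1 * y \in K.
  move=> fxy; apply: coset_idr => //.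
  by rewrite morphM ?morphV //= -/f fxy mulVg.
pose fib (X : {set gT}) c := X :&: f @^-1: [set c].
have fibP X c x : (x \in fib X c) = (x \in X) && (f x == c) by rewrite !inE.
set S := restricted_prodset A; pose M := f @: A.
have sMH : M \subset H / K.
  apply/subsetP=> _ /imsetP[x xA ->]; apply: mem_quotient; exact: (subsetP sAH).
have sum_fib (X : {set gT}) (P : {set coset_of K}) : f @: X \subset P ->
    (\sum_(c in P) #|fib X c| = #|X|)%N.
  move=> sXP; rewrite sum_card_preim1; congr #|pred_of_set _|; apply/setIidPl.
  by rewrite -sub_imset_pre.
have fib_gt0 c : (0 < #|fib A c|)%N = (c \in M).
  apply/card_gt0P/imsetP => [[x]|[x xA ->]]; last first.
    by exists x; rewrite fibP xA eqxx.
  by rewrite fibP => /andP[xA /eqP]; exists x.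
have [/existsP[c0 c0_ge2]|small] := boolP [exists c, (1 < #|fib A c|)%N];
    last first.
  have f_inj : {in A &, injective f}.
    move=> x y xA yA fxy; apply/eqP; apply: contraNT small => xy.
    apply/existsP; exists (f x); rewrite (cardsD1 x) (cardsD1 y).
    by rewrite fibP xA eqxx !inE /= eq_sym xy yA fxy eqxx.
  have cM : #|M| = #|A| by apply: card_in_imset.
  rewrite -cM; apply: leq_trans (EH_HK M sMH _) _; first by rewrite cM.
  rewrite leq_add2r; apply: leq_trans (leq_imset_card f S).
  apply: subset_leq_card; apply/subsetP=> z /imset2P[u v /imsetP[x xA ->]].
  rewrite inE => /andP[/imsetP[y yA ->] fxy] ->; rewrite -fM.
  apply: imset_f; apply: mem_restricted_prodset => //.
  by apply: contraNneq fxy => ->.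
pose c1 := [arg max_(c > c0) #|fib A c|].
have c1_max c : (#|fib A c| <= #|fib A c1|)%N.
  by rewrite /c1; case: arg_maxnP => // i _; apply.
set k := #|fib A c1| in c1_max.
have k_ge2 : (1 < k)%N by apply: leq_trans (c1_max c0).
pose U := [set c | #|fib A c| == k].
have sUM : U \subset M.
  by apply/subsetP=> c; rewrite inE -fib_gt0 => /eqP->; apply: ltnW.
have c1U : c1 \in U by rewrite inE.
have c1M : c1 \in M := subsetP sUM c1 c1U.
have sumA : (\sum_(c in M) #|fib A c| = #|A|)%N by apply: sum_fib.
have lekA c : c \in M -> c != c1 -> (k + #|fib A c| <= #|A|)%N.
  move=> cM cc1; rewrite -sumA (bigD1 c1) //= leq_add2l (bigD1 c) ?cM //=.
  exact: leq_addr.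
have sumU : (\sum_(c in M) (c \in U) = #|U|)%N.
  rewrite -sum1_card [RHS]big_mkcond [LHS]big_mkcond; apply: eq_bigr => c _.
  by have := subsetP sUM c; case: (c \in U) => [-> //|_]; rewrite if_same.
(* Each coset in [M] contributes at least 1 to |A|, and each in [U] at least 2. This is the size
   condition for Cauchy-Davenport in [H / K]. *)
have leUM : (#|U| + #|M| <= #|A|)%N.
  rewrite -sumU -sum1_card -big_split -sumA; apply: leq_sum => c cM.
  by have := fib_gt0 c; rewrite cM inE /=; case: eqP => /=; lia.
have fib_neq0 c : c \in M -> fib A c != set0 by rewrite -card_gt0 fib_gt0.
have mem_fibS x y c d : x \in fib A c -> y \in fib A d -> x != y ->
    x * y \in fib S (c * d).
  rewrite !fibP => /andP[xA /eqP<-] /andP[yA /eqP<-] xy.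
  by rewrite fM eqxx andbT; apply: mem_restricted_prodset.
have fibK c : {in fib A c &, forall x y, x^-1 * y \in K}.
  move=> x y; rewrite !fibP => /andP[_ /eqP fx] /andP[_ /eqP fy].
  by apply: fK; rewrite fx.
have leA1 : (#|A| <= p.+1)%N by lia.
have fibS_c1 : (2 * k <= #|fib S (c1 * c1)%g| + 3)%N.
  have /set0Pn[x xc1] := fib_neq0 _ c1M.
  have sBK : x^-1 *: fib A c1 \subset K.
    by apply/subsetP=> _ /lcosetP[y yc1 ->]; apply: fibK yc1.
  have := EH_K _ sBK; rewrite card_lcoset card_restricted_prodset_lcoset // -/k.
  have leK : (2 * k <= p + 3)%N.
    apply: leq_trans leA; rewrite leq_mul2l -sumA (bigD1 c1) //=.
    exact: leq_addr.
  move/(_ leK)=> leS; apply: leq_trans leS _; rewrite leq_add2r.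
  apply: subset_leq_card; apply/subsetP=> z /imset2P[u v uc1].
  by rewrite inE => /andP[vc1 uv] ->; apply: mem_fibS.
(* Cauchy-Davenport gives k + |fib A c| - 1 products, and k >= |fib A c| + 1 unless c is in [U];
   only then is one lost. *)
have fibS c : c \in M -> c != c1 ->
    (2 * #|fib A c| <= #|fib S (c1 * c)%g| + (c \in U))%N.
  move=> cM cc1; have := lekA c cM cc1 => leKc.
  have := cauchy_davenport mulC (prime_divisors_ge_dvdn (cardSg sKH) Hp)
            (fib_neq0 _ c1M) (fib_neq0 _ cM) (@fibK c) (leq_trans leKc leA1).
  have sS : fib A c1 * fib A c \subset fib S (c1 * c).
    apply/subsetP=> _ /mulsgP[x y xc1 yc ->]; apply: mem_fibS => //.
    apply: contraNneq cc1 => xy; move: xc1 yc; rewrite xy !fibP.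
    by move=> /andP[_ /eqP<-] /andP[_ /eqP<-].
  move=> leAA; have : (k + #|fib A c| <= #|fib S (c1 * c)%g| + 1)%N.
    by apply: leq_trans leAA _; rewrite leq_add2r subset_leq_card.
  by have := c1_max c; rewrite inE -/k; case: eqP => /=; lia.
(* A coset in [U] has k >= 2 points, so one of them differs from the chosen y even when u = c. *)
have fibS_gt0 s : s \in U * M -> (0 < #|fib S s|)%N.
  case/mulsgP=> u c uU cM ->; have /set0Pn[y yc] := fib_neq0 _ cM.
  have [x] : exists x, x \in fib A u :\ y.
    apply/card_gt0P; move: uU; rewrite inE => /eqP.
    by rewrite (cardsD1 y); case: (_ \in _) => /=; lia.
  rewrite in_setD1 => /andP[xy xu].
  by apply/card_gt0P; exists (x * y); apply: mem_fibS.
have cd : (#|U| + #|M| <= #|(U * M)%g| + 1)%N.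
  have HKp : prime_divisors_ge p #|(H / K)%g|.
    exact: prime_divisors_ge_dvdn (dvdn_quotient _ _) Hp.
  apply: cauchy_davenport mulCq HKp _ _ _ (leq_trans leUM leA1).
  - by apply/set0Pn; exists c1.
  - by apply/set0Pn; exists c1.
  by move=> c d /(subsetP sMH) cH /(subsetP sMH) dH; rewrite groupM ?groupV.
pose c1_M := [set c1 * c | c in M].
have s_c1_M : c1_M \subset U * M.
  by apply/subsetP=> _ /imsetP[c cM ->]; apply: mem_mulg.
have card_c1_M : #|c1_M| = #|M| by apply: card_imset; apply: mulgI.
have leS : (\sum_(s in (U * M)%g) #|fib S s| <= #|S|)%N.
  by rewrite sum_card_preim1 subset_leq_card // subsetIl.
apply: (@leq_trans (\sum_(s in (U * M)%g) #|fib S s| + 3));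
  last by rewrite leq_add2r.
rewrite (big_setID c1_M) /= (setIidPr s_c1_M).
(* The term c = c1 gives 2k - 3 and the others lose |U| - 1 in all, as c1 itself lies in [U]. *)
have le_c1_M : (2 * #|A| + 1 <= \sum_(s in c1_M) #|fib S s| + 3 + #|U|)%N.
  rewrite big_imset /=; last by move=> u v _ _; apply: mulgI.
  rewrite -sumA -sumU [(\sum_(c in M) (c \in U))%N](bigD1 c1) // c1U.
  rewrite [(\sum_(c in M) #|fib A c|)%N](bigD1 c1) //.
  rewrite [(\sum_(c in M) #|fib S _|)%N](bigD1 c1) //= -/k.
  have : (\sum_(c in M | c != c1) 2 * #|fib A c| <=
     \sum_(c in M | c != c1) (#|fib S (c1 * c)%g| + (c \in U)))%N.
    by apply: leq_sum => c /andP[cM cc1]; apply: fibS.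
  rewrite -big_distrr big_split /= => le_sum.
  have arith a b c d : (2 * k <= a + 3 -> 2 * b <= c + d ->
    2 * (k + b) + 1 <= a + c + 3 + (1 + d))%N by lia.
  exact: arith fibS_c1 le_sum.
have le_rest :
    (#|(U * M)%g :\: c1_M| <= \sum_(s in (U * M)%g :\: c1_M) #|fib S s|)%N.
  rewrite -sum1_card; apply: leq_sum => s; rewrite inE => /andP[_].
  exact: fibS_gt0.
have := cardsID c1_M (U * M)%g; rewrite (setIidPr s_c1_M) card_c1_M => card_UM.
have arith a u m t r y z : (2 * a + 1 <= y + 3 + u -> r <= z ->
  u + m <= t + 1 -> m + r = t -> 2 * a <= y + z + 3)%N by lia.
exact: arith le_c1_M le_rest cd card_UM.
Qed.

(** * Karolyi's theorem for commutative groups *)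

(** Induction on |H| over all group types, because [H / K] lives in another type; [K] is generated
    by an element of prime order, from Cauchy's theorem. *)
Lemma erdos_heilbronn_commutative (gT : finGroupType) (p : nat)
    (H : {group gT}) (A : {set gT}) :
    commutative (@mulg gT) -> prime_divisors_ge p #|H| ->
    A \subset H -> (2 * #|A| <= p + 3)%N ->
  (2 * #|A| <= #|restricted_prodset A| + 3)%N.
Proof.
have [m] := ubnP #|H|; elim: m gT H A => // m IHm gT H A ltHm mulC Hp sAH leA.
have [H_le1 | H_gt1] := leqP #|H| 1.
  by have := leq_trans (subset_leq_card sAH) H_le1; lia.
have [H_pr | H_npr] := boolP (prime #|H|).
  apply: erdos_heilbronn_prime_order H_pr sAH _; apply: leq_trans leA _.
  by rewrite leq_add2r leq_prime_divisors_ge.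
have [x xH ox] := Cauchy (pdiv_prime H_gt1) (pdiv_dvd _).
have sKH : <[x]> \subset H by rewrite cycle_subG.
have K_pr : prime #|<[x]>| by rewrite -orderE ox pdiv_prime.
have ltKH : (#|<[x]>| < #|H|)%N.
  rewrite ltn_neqAle subset_leq_card // andbT.
  by apply: contraNneq H_npr => <-.
have ltHK : (#|H / <[x]>| < #|H|)%N.
  by rewrite ltn_quotient // -cardG_gt1 prime_gt1.
apply: (@erdos_heilbronn_extension gT p H <[x]>%G) => // B sB leB.
  apply: IHm sB leB => //; first exact: leq_trans ltKH ltHm.
  exact: prime_divisors_ge_dvdn (cardSg sKH) Hp.
apply: IHm sB leB => //; first exact: leq_trans ltHK ltHm.
  exact: coset_of_mulC.
exact: prime_divisors_ge_dvdn (dvdn_quotient _ _) Hp.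
Qed.

(** When 2|A| exceeds p + 3, a subset of (p + 3)/2 points already yields p products. For p = 2 this
    is not an integer, and three points x, y, z give xy and xz. *)
Lemma leq_minn_card_restricted_prodset (gT : finGroupType) (H : {group gT})
    (A : {set gT}) :
    commutative (@mulg gT) -> (1 < #|H|)%N -> A \subset H ->
  (minn (pdiv #|H|) (2 * #|A| - 3) <= #|restricted_prodset A|)%N.
Proof.
move=> mulC H_gt1 sAH; set p := pdiv #|H|.
have Hp : prime_divisors_ge p #|H|.
  by move=> q q_pr qH; apply: pdiv_min_dvd => //; apply: prime_gt1.
have [leA | ltA] := leqP (2 * #|A|) (p + 3).
  have := erdos_heilbronn_commutative mulC Hp sAH leA; lia.
apply: leq_trans (geq_minl _ _) _.
have p_pr : prime p by apply: pdiv_prime.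
have [p2 | p_odd] := even_prime p_pr.
  have /card_gt2P[x [y [z [[xA yA zA] [xy yz zx]]]]] : (2 < #|A|)%N by lia.
  have <- : #|[set x * y; x * z]| = p.
    by rewrite cards2 (inj_eq (mulgI x)) yz p2.
  apply: subset_leq_card; rewrite subUset !sub1set.
  by rewrite !mem_restricted_prodset // eq_sym.
have /card_geqP[s [us ss sA]] : ((p + 3)./2 <= #|A|)%N by lia.
have sBA : [set x in s] \subset A by apply/subsetP=> x; rewrite inE; apply: sA.
have cB : (2 * #|[set x in s]| = p + 3)%N.
  by rewrite cardsE (card_uniqP us) ss; lia.
apply: leq_trans (subset_leq_card (restricted_prodsetS sBA)).
rewrite -(leq_add2r 3) -cB.
apply: erdos_heilbronn_commutative Hp (subset_trans sBA sAH) _ => //.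
by rewrite cB.
Qed.

(** * Counting products coset by coset *)

Lemma card_restricted_prodset_lcosets (gT : finGroupType) (H : {group gT})
    (A : {set gT}) a :
    commutative (@mulg gT) -> a \in A ->
  (#|restricted_prodset (A :&: a *: H)| +
     (#|[set x *: H | x in A]|.-1) * #|A :&: a *: H| <=
   #|restricted_prodset A|)%N.
Proof.
move=> mulC aA; pose f (x : gT) := x *: H; rewrite -/f.
set M := [set x *: H | x in A]; set X := A :&: a *: H.
set S := restricted_prodset A.
have fM x y : f (x * y) = x *: f y by rewrite /f lcosetM.
have aM : a *: H \in M by apply: imset_f.
have fX x : x \in X -> f x = f a.
  by rewrite inE => /andP[_ xa]; apply/lcoset_eqP.
have lcoset_inj : injective (fun D : {set gT} => a *: D).
  by move=> D E /(congr1 (fun Z => a^-1 *: Z)); rewrite -!lcosetM !mulVg !mul1g.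
pose M' := [set a *: D | D : {set gT} in M].
have le_X : (#|restricted_prodset X| <= #|S :&: f @^-1: [set a *: (a *: H)]|)%N.
  apply: subset_leq_card; rewrite subsetI restricted_prodsetS ?subsetIl //=.
  apply/subsetP=> z /imset2P[x y xX]; rewrite inE => /andP[yX _] ->.
  by rewrite !inE fM (fX y yX) -fM mulC fM (fX x xX).
(* The restriction costs nothing here: x and d lie in different cosets, hence differ. *)
have le_D D : D \in M -> D != a *: H ->
    (#|X| <= #|S :&: f @^-1: [set a *: D]|)%N.
  move=> /imsetP[d dA ->] dnA; rewrite -(card_rcoset X d).
  apply: subset_leq_card; apply/subsetP=> _ /rcosetP[x xX ->].
  have fxd : f (x * d) = a *: (d *: H) by rewrite mulC fM (fX x xX) -fM mulC fM.
  rewrite inE !inE fxd eqxx andbT.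
  have xA : x \in A by move: xX; rewrite inE => /andP[].
  apply: mem_restricted_prodset => //.
  by apply: contraNneq dnA => <-; rewrite -/(f x) fX.
apply: (@leq_trans (\sum_(D in M') #|S :&: f @^-1: [set D]|)); last first.
  by rewrite sum_card_preim1 subset_leq_card // subsetIl.
rewrite big_imset /=; last by move=> D E _ _; apply: lcoset_inj.
rewrite (bigD1 (a *: H)) //=; apply: leq_add => //.
rewrite (cardsD1 (a *: H)) aM /= -sum_nat_const.
rewrite [X in (_ <= X)%N](eq_bigl (mem (M :\ a *: H))).
  by apply: leq_sum => D; rewrite !inE => /andP[DA DM]; apply: le_D.
by move=> D; rewrite !inE andbC.
Qed.

End GroupSumsets.

(** * The bound in the cyclic group *)

Theorem theorem6 (n : nat) (hn : (2 <= n)%N)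
    (H : {group 'Z_n}) (t : nat) (hHt : #|H| = t) (ht : (3 <= t)%N)
    (A : {set 'Z_n})
    (C : {set 'Z_n}) (hC : C \in cosets H)
    (hmax : forall D : {set 'Z_n}, D \in cosets H ->
              (#|A :&: D| <= #|A :&: C|)%N) :
  let x : nat := #|A :&: C| in
  let r : int := (num_cosets_meeting H A)%:Z - 1 in
  alpha_star t x + r * x%:Z <= #|restricted_sumset A|%:Z.
Proof.
lazy zeta; set x := #|A :&: C|.
have mulC : commutative (@mulg 'Z_n) by move=> u v; apply: addrC.
have eM : [set D in cosets H | A :&: D != set0] = [set (u *: H)%g | u in A].
  apply/setP=> D; rewrite inE; apply/andP/imsetP.
    case=> /lcosetsP[u _ ->] /set0Pn[v]; rewrite inE => /andP[vA vu].
    by exists v => //; apply/esym/lcoset_eqP.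
  case=> u uA ->; split; first by apply/lcosetsP; exists u; rewrite ?inE.
  by apply/set0Pn; exists u; rewrite inE uA lcoset_refl.
(* For empty [A], r = -1, but x = 0 makes both terms vanish. *)
have [A0 | /set0Pn[b bA]] := eqVneq A set0.
  have -> : x = 0%N by rewrite /x A0 set0I cards0.
  by rewrite mulr0 addr0 /alpha_star; lia.
have x_gt0 : (0 < x)%N.
  apply: leq_trans (hmax (b *: H)%g _); last first.
    by apply/lcosetsP; exists b; rewrite ?inE.
  by apply/card_gt0P; exists b; rewrite inE bA lcoset_refl.
have [a] := card_gt0P x_gt0; rewrite inE => /andP[aA aC].
have eC : C = (a *: H)%g.
  by move: hC aC => /lcosetsP[u _ ->] au; apply/esym/lcoset_eqP.
have := card_restricted_prodset_lcosets H mulC aA; rewrite -eM -eC.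
rewrite -/(num_cosets_meeting H A) -/x.
have M_gt0 : (0 < num_cosets_meeting H A)%N.
  rewrite /num_cosets_meeting eM; apply/card_gt0P.
  by exists (a *: H)%g; apply: imset_f.
(* Translation into [H] preserves the number of restricted products, so the bound in [H] applies to
   the part of [A] in [C]. *)
have sXH : (a^-1 *: (A :&: C) \subset H)%g.
  apply/subsetP=> _ /lcosetP[u uX ->]; rewrite -mem_lcoset -eC.
  by move: uX; rewrite inE => /andP[].
have := leq_minn_card_restricted_prodset mulC _ sXH.
rewrite card_lcoset card_restricted_prodset_lcoset // hHt -/x => /(_ (ltnW ht)).
have -> : restricted_prodset A = restricted_sumset A by [].
clearbody x; move: M_gt0; clear hmax x_gt0; rewrite /alpha_star.
move: (num_cosets_meeting H A) (pdiv t) #|restricted_sumset A|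
  #|restricted_prodset _| (x : nat) => m p s u y.
case: m => // m _; rewrite (_ : m.+1%:Z - 1 = m%:Z) /= => [le_u le_s|];
  last by lia.
(* Truncated subtraction plays the part of the maximum with 0 in [alpha_star]. *)
have : (minn p (2 * y - 3) + m * y <= s)%N by lia.
rewrite -(lez_nat _ s) PoszD PoszM; lia.
Qed.
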